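(* Let $A,P,B,O$ be four distinct points in a Ptolemaic metric $d$ and suppose that \[ d(A,B)=d(A,P)+d(P,B). \] Let $1\le q\le\log_2 3$ and let $\chi_q=\chi_q(A,B\mid P;O)$ be the partial correlation. Then \[ -\kappa_q\le\chi_q\le\lambda_q, \] where \[ \kappa_q=\frac{2^{q+1}-3}{3},\qquad \lambda_q=\frac{(2^q-2)^2}{4-(2^q-2)^2}. \] The lower constant $-\kappa_q$ is sharp. At $q=\log_2(9/4)$ it equals $-1/2$.
   Context: A metric is Ptolemaic if $d(x,y)d(z,w)\le d(x,z)d(y,w)+d(x,w)d(y,z)$ for all points $x,y,z,w$. Partial correlation: for distinct points $P,A,B,O$, let $G$ be the Schoenberg matrix of $d^{q/2}$ based at $P$, \[ G_{XY}=\frac{d(P,X)^q+d(P,Y)^q-d(X,Y)^q}{2}, \qquad X,Y\in\{A,B,O\}, \] and for $X,Y\in\{A,B\}$ put $S_{XY}=G_{XY}-\dfrac{G_{XO}G_{OY}}{G_{OO}}$. When $S_{AA}S_{BB}>0$, define \[ \chi_q(A,B\mid P;O)=\frac{S_{AB}}{\sqrt{S_{AA}S_{BB}}}. \] (For four distinct points and $q<2$ one has $S_{AA},S_{BB}>0$.) Sharpness means that the bound $-\kappa_q$ cannot be replaced by a larger number. *)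

(* Defs.v *)
From mathcomp Require Import all_boot all_order all_algebra.
From mathcomp Require Import all_classical all_reals all_analysis.

Set Implicit Arguments.
Unset Strict Implicit.
Unset Printing Implicit Defensive.

Import Order.TTheory GRing.Theory Num.Theory.
Import numFieldNormedType.Exports.

Local Open Scope ring_scope.

Definition log2 (R : realType) (x : R) : R := ln x / ln 2.

Definition ptolemaic (R : realType) (X : metricType R) : Prop :=
  forall x y z w : X,
    mdist x y * mdist z w <= mdist x z * mdist y w + mdist x w * mdist y z.

(* The entry G_XY of the Schoenberg matrix of d^(q/2) based at P; the squared
   distances of d^(q/2) are d^q. Since powR satisfies 0 `^ q = 0 for q != 0,
   the diagonal entry is G_XX = d(P,X)^q. *)
Definition schoenberg (R : realType) (X : metricType R) (q : R) (P : X)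
    (x y : X) : R :=
  (mdist P x `^ q + mdist P y `^ q - mdist x y `^ q) / 2.

(* The entry S_XY of the Schur complement of G_OO in G. *)
Definition schur (R : realType) (X : metricType R) (q : R) (P O : X)
    (x y : X) : R :=
  let G := schoenberg q P in G x y - G x O * G O y / G O O.

(* chi_q(A, B | P; O). The conventions for division by 0 and for square roots
   of negative numbers play no role for four distinct points and 0 < q < 2,
   because S_AA and S_BB are then positive. *)
Definition partial_corr (R : realType) (X : metricType R) (q : R)
    (A B P O : X) : R :=
  let S := schur q P O in S A B / Num.sqrt (S A A * S B B).

Definition kappa (R : realType) (q : R) : R := (2 `^ (q + 1) - 3) / 3.

Definition lambda (R : realType) (q : R) : R :=
  (2 `^ q - 2) ^+ 2 / (4 - (2 `^ q - 2) ^+ 2).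

(* Main.v *)
(** Put [m = 2^(q-1) - 1], so that [0 <= m <= 1/2], [kappa q = (4 m + 1) / 3]
    and [lambda q = m^2 / (1 - m^2)]. Everything rests on the inequality
    [(x + y)^q <= x^q + y^q + 2 m (x y)^(q/2)]. It gives every triangle of the
    metric a Euclidean comparison triangle with sides [d^(q/2)] all of whose
    angles have cosine at least [-m], hence are at most [2 pi / 3].

    Lower bound. The partial correlation is the cosine of the dihedral angle at
    the edge [PO], computed from the angles at [P] of the comparison triangles
    [PAO] and [PBO] and from the angle [APB]. It can equally be computed from
    the angles at [O], or, after an inversion at [P], from the angles at [A] and
    [B]; the third angle then has cosine at least [-m] by the position
    of [P] between [A] and [B], by the triangle inequality, and by the Ptolemaic
    inequality respectively. The
    angles of both triangles add up to [2 pi], so one of the three pairs has a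
    sum between [2 pi / 3] and [4 pi / 3], and this pair gives the bound.

    Upper bound. Only the case where [G_AO] and [G_BO] have opposite signs
    matters. It reduces to four points on a line, where concavity of [t^(q-1)]
    and the basic inequality suffice. *)
From HB Require Import structures.
Require Import Defs.
From mathcomp Require Import all_boot all_order all_algebra.
From mathcomp Require Import all_classical all_reals all_analysis.
From mathcomp Require Import ring lra.

Import Order.TTheory GRing.Theory Num.Theory.
Import numFieldNormedType.Exports.

Local Open Scope ring_scope.

(** * Chord inequalities for powers and the additivity defect of [t^q] *)

Lemma powR_convex_chord (R : realType) (q x y z : R) : 1 <= q ->
  0 <= x -> x <= y -> y <= z ->
  (z - x) * y `^ q <= (z - y) * x `^ q + (y - x) * z `^ q.
Proof.
move=> q1 x0 xy yz; have [xz|zx] := ltP x z; last first.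
  have -> : y = x by lra.
  have -> : z = x by lra.
  by lra.
have zx0 : 0 < z - x by lra.
pose t := (z - y) / (z - x).
have t0 : 0 <= t by rewrite divr_ge0; lra.
have t1 : t <= 1 by rewrite ler_pdivrMr//; lra.
have tz : t * (z - x) = z - y by rewrite /t divfK// gt_eqF.
have : (t * x + (1 - t) * z) `^ q <= t * x `^ q + (1 - t) * z `^ q.
  apply: (@convex_powR R q q1 (Itv01 t0 t1) x z);
    by rewrite inE/= in_itv/= andbT//; lra.
have -> : t * x + (1 - t) * z = y by lra.
move=> /(ler_wpM2l (ltW zx0)) /le_trans; apply.
have -> : y - x = (z - x) - (z - y) by ring.
by rewrite -tz le_eqVlt; apply/orP; left; apply/eqP; ring.
Qed.

(* Concavity of [t `^ e] is convexity of its inverse [t `^ e^-1]. *)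
Lemma powR_concave_chord (R : realType) (e x y z : R) : 0 < e -> e <= 1 ->
  0 <= x -> x <= y -> y <= z ->
  (z - y) * x `^ e + (y - x) * z `^ e <= (z - x) * y `^ e.
Proof.
move=> e0 e1 x0 xy yz; have [xz|zx] := ltP x z; last first.
  have -> : y = x by lra.
  have -> : z = x by lra.
  by lra.
have zx0 : 0 < z - x by lra.
have y0 := le_trans x0 xy; have z0 := le_trans y0 yz.
pose t := (z - y) / (z - x).
have t0 : 0 <= t by rewrite divr_ge0; lra.
have t1 : t <= 1 by rewrite ler_pdivrMr//; lra.
have tz : t * (z - x) = z - y by rewrite /t divfK// gt_eqF.
have ie1 : 1 <= e^-1 by rewrite invf_ge1.
have : (t * x `^ e + (1 - t) * z `^ e) `^ e^-1 <=
    t * (x `^ e) `^ e^-1 + (1 - t) * (z `^ e) `^ e^-1.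
  by apply: (@convex_powR R _ ie1 (Itv01 t0 t1) (x `^ e) (z `^ e));
    rewrite inE/= in_itv/= andbT powR_ge0.
rewrite -!powRrM divff ?gt_eqF// !powRr1//.
have -> : t * x + (1 - t) * z = y by lra.
have s0 : 0 <= t * x `^ e + (1 - t) * z `^ e.
  by rewrite addr_ge0// mulr_ge0 ?powR_ge0//; lra.
move=> /(ge0_ler_powR (ltW e0)); rewrite !nnegrE powR_ge0 y0 => /(_ isT isT).
rewrite -powRrM mulVf ?gt_eqF// powRr1// => /(ler_wpM2l (ltW zx0)).
apply: le_trans; have -> : y - x = (z - x) - (z - y) by ring.
by rewrite -tz le_eqVlt; apply/orP; left; apply/eqP; ring.
Qed.

Lemma powR_succ (R : realType) (q x : R) : 1 <= q -> 0 <= x ->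
  x `^ q = x * x `^ (q - 1).
Proof. by move=> q1 x0; rewrite mulr_powRB1//; lra. Qed.

Lemma powR_half_sqr (R : realType) (q x : R) : (x `^ (q / 2)) ^+ 2 = x `^ q.
Proof.
by rewrite -powR_mulrn ?powR_ge0// -powRrM divfK// pnatr_eq0.
Qed.

(* The quotient [((1 + s)^q - 1 - s^q) / s^(q/2)] is nonincreasing on [s >= 1]:
   its derivative has the sign of [1 + (s - 1) (1 + s)^(q-1) - s^q], which is
   nonpositive by concavity of [t^(q-1)] at [1 <= s <= s + 1]. *)
Lemma powR_defect_le1 (R : realType) (q s : R) : 1 < q -> q <= 2 -> 1 <= s ->
  ((1 + s) `^ q - 1 - s `^ q) * s `^ (- (q / 2)) <= 2 `^ q - 2.
Proof.
move=> q1 q2 s1.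
pose f x : R := ((1 + x) `^ q - 1 - x `^ q) * x `^ (- (q / 2)).
have df (x : R) : 0 < x -> is_derive x 1 f
   ((q * (1 + x) `^ (q - 1) - q * x `^ (q - 1)) * x `^ (- (q / 2)) +
    ((1 + x) `^ q - 1 - x `^ q) * (- (q / 2) * x `^ (- (q / 2) - 1))).
  move=> x0; have x10 : 0 < 1 + x by lra.
  have d1 : is_derive x 1 (fun x : R => (1 + x) `^ q) (q * (1 + x) `^ (q - 1)).
    rewrite -[X in is_derive _ _ _ X]mulr1.
    apply: (@is_derive1_comp R (fun y => y `^ q) (fun y => 1 + y) x
      (q * (1 + x) `^ (q - 1)) 1).
      exact: is_derive1_powR.
    by rewrite -[X in is_derive _ _ _ X]add0r; apply: is_deriveD.
  have d2 := is_derive1_powR q x0.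
  have d3 := is_derive1_powR (- (q / 2)) x0.
  rewrite /f; apply: is_derive_eq.
  rewrite /GRing.scale/=; ring.
have -> : 2 `^ q - 2 = f 1.
  by rewrite /f !powR1 (_ : 1 + 1 = 2)//; ring.
apply: (@ler0_derive1_nincry R f 1) => //.
- by move=> x; rewrite in_itv/= andbT => x1; have [] := df x (lt_trans ltr01 x1).
- move=> x; rewrite in_itv/= andbT => x1.
  have x0 : 0 < x by lra.
  have d := df x x0; rewrite derive1E derive_val.
  have c := @powR_concave_chord R (q - 1) 1 x (x + 1) ltac:(lra) ltac:(lra)
    ltac:(lra) ltac:(lra) ltac:(lra).
  rewrite powR1 in c.
  have -> : x `^ (- (q / 2)) = x * x `^ (- (q / 2) - 1).
    rewrite -{2}(powRr1 (ltW x0)) -powRD; last by rewrite (gt_eqF x0) implybT.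
    by congr (_ `^ _); ring.
  rewrite !(@powR_succ R q) ?(ltW x0)//; try lra.
  rewrite (addrC 1 x).
  have E0 := powR_ge0 x (- (q / 2) - 1).
  set E := x `^ (- (q / 2) - 1) in E0 *.
  set u := (x + 1) `^ _ in c *; set v := x `^ (q - 1) in c *.
  have -> : (q * u - q * v) * (x * E) +
    ((x + 1) * u - 1 - x * v) * (- (q / 2) * E) =
    - ((q / 2 * E) * (x * v - 1 - (x - 1) * u)) by field.
  rewrite oppr_le0 mulr_ge0// ?mulr_ge0//; lra.
- apply: derivable_within_continuous => x; rewrite in_itv/= andbT => x1.
  by have [] := df x (lt_le_trans ltr01 x1).
Qed.

(** By symmetry and homogeneity only [s = x / y >= 1] matters, where the quotient bounded in
    [powR_defect_le1] is largest at [s = 1]. *)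
Lemma powR_add_le (R : realType) (q x y : R) : 1 <= q -> q <= 2 ->
  0 <= x -> 0 <= y ->
  (x + y) `^ q <= x `^ q + y `^ q + (2 `^ q - 2) * (x `^ (q / 2) * y `^ (q / 2)).
Proof.
move=> q1 q2; wlog xy : x y / y <= x.
  move=> H x0 y0; have [/H->//|/ltW/H] := leP y x.
  by rewrite addrC [y `^ _ + _]addrC [y `^ _ * _]mulrC; apply.
move=> x0; rewrite le_eqVlt => /predU1P[<-|y0].
  rewrite addr0 !powR0 ?mulr0 ?addr0//; lra.
have [->|q1'] := eqVneq q 1.
  by rewrite !powRr1 ?subrr ?mul0r ?addr0//; lra.
have {}x0 : 0 < x by lra.
pose s := x / y.
have s1 : 1 <= s by rewrite ler_pdivlMr// mul1r.
have := @powR_defect_le1 R q s ltac:(by rewrite lt_neqAle eq_sym q1') q2 s1.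
have s0 : 0 < s by lra.
rewrite powRN ler_pdivrMr ?powR_gt0// => H.
have xE : x = s * y by rewrite /s divfK// gt_eqF.
have -> : x + y = (1 + s) * y by rewrite {1}xE; ring.
rewrite {}xE; move: s s1 s0 H {xy x0} => s s1 s0 H.
rewrite !powRM; try lra.
have Yq := powR_gt0 q y0; rewrite -(powR_half_sqr R q y) in Yq *.
by move: H; rewrite -(ler_pM2r Yq); lra.
Qed.

(** Put [h(t) = (a + t)^q - a^q - t^q] and [e = q - 1]. Then [h(t) / t] is the sum of
    [a ((a + t)^e - a^e) / t] and [(a + t)^e - t^e], both nonincreasing in [t] by concavity of
    [t^e]. *)
Lemma powR_defect_scale (R : realType) (q a b p : R) : 1 <= q -> q <= 2 ->
  0 <= a -> 0 < b -> b <= p ->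
  b * ((a + p) `^ q - a `^ q - p `^ q) <= p * ((a + b) `^ q - a `^ q - b `^ q).
Proof.
move=> q1 q2 a0 b0 bp.
have [->|qn1] := eqVneq q 1; first by rewrite !powRr1; lra.
rewrite !(@powR_succ R q); try lra.
have e0 : 0 < q - 1 by rewrite lt_neqAle eq_sym subr_eq0 qn1/=; lra.
have e1 : q - 1 <= 1 by lra.
have c1 := @powR_concave_chord R (q - 1) a (a + b) (a + p) e0 e1
  a0 ltac:(lra) ltac:(lra).
have c2 := @powR_concave_chord R (q - 1) b p (a + p) e0 e1
  (ltW b0) bp ltac:(lra).
have c3 := @powR_concave_chord R (q - 1) b (a + b) (a + p) e0 e1
  (ltW b0) ltac:(lra) ltac:(lra).
move: c1 c2 c3.
set A := a `^ _; set B := b `^ _; set P := p `^ _.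
set AB := (a + b) `^ _; set AP := (a + p) `^ _ => c1 c2 c3.
have k : AP - P <= AB - B.
  have [ab0|ab0] := ltP 0 (a + p - b); last first.
    have ea : a = 0 by lra.
    have eb : b = p by lra.
    by rewrite /AP /AB /P /B ea eb.
  by rewrite -(ler_pM2l ab0); lra.
have bp0 : 0 < b * p by apply: mulr_gt0; lra.
have := ler_wpM2l (ltW bp0) k; have := ler_wpM2l a0 c1; lra.
Qed.

(** Increments of the convex function [t^q] over intervals of length [a] grow with the left
    endpoint. *)
Lemma powR_defect_mono (R : realType) (q a b p : R) : 1 <= q ->
  0 <= a -> 0 <= p -> p <= b ->
  (a + p) `^ q - a `^ q - p `^ q <= (a + b) `^ q - a `^ q - b `^ q.
Proof.
move=> q1 a0 p0 pb.
have c2 := @powR_convex_chord R q p b (a + b) q1 p0 pb ltac:(lra).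
have c3 := @powR_convex_chord R q p (a + p) (a + b) q1 p0 ltac:(lra) ltac:(lra).
have [ab0|ab0] := ltP 0 (a + b - p); last first.
  have -> : a = 0 by lra.
  have -> : p = b by lra.
  by [].
by rewrite -(ler_pM2l ab0); lra.
Qed.

(** * Angles of comparison triangles *)

Lemma cos_pi3 (R : realType) : cos (pi / 3 : R) = 1 / 2.
Proof.
have pi0 := pi_gt0 R.
set t : R := pi / 3.
have c0 : 0 < cos t by apply: cos_gt0_pihalf; rewrite /t; lra.
have : cos (t + (t + t)) = -1 by rewrite -(cospi R); congr cos; rewrite /t; lra.
have := cos2Dsin2 t; rewrite !(cosD, sinD).
set c := cos t in c0 *; set s := sin t => h1 h2.
(* This is [4 c^3 - 3 c + 1 = 0], the triple-angle formula for [cos (3 t) = -1]; [c > 0] selects the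
   root. *)
have : (c + 1) * (2 * c - 1) ^+ 2 = 0.
  transitivity (c * (c * c - s * s) - s * (s * c + c * s) + 1 +
     3 * c * (c ^+ 2 + s ^+ 2 - 1)); first ring.
  by rewrite h1 h2; ring.
move/eqP; rewrite mulf_eq0 sqrf_eq0 => /orP[] /eqP; lra.
Qed.

Lemma cos_two_pi3 (R : realType) : cos (2 * (pi / 3) : R) = - (1 / 2).
Proof.
have -> : 2 * (pi / 3) = (pi / 3) *+ 2 :> R by rewrite mulr_natl.
by rewrite cos_mulr2n cos_pi3; lra.
Qed.

Lemma ge_cos_two_pi3 (R : realType) (t : R) : 0 <= t -> t <= pi ->
  - (1 / 2) <= cos t -> t <= 2 * (pi / 3).
Proof.
move=> t0 tpi; rewrite -cos_two_pi3; apply: contraTT.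
have pi0 := pi_gt0 R.
by rewrite -!ltNge => h; rewrite ltr_cos// in_itv/=; apply/andP; split; lra.
Qed.

Lemma cos_le_Nhalf (R : realType) (t : R) :
  2 * (pi / 3) <= t -> t <= 4 * (pi / 3) -> cos t <= - (1 / 2).
Proof.
have pi0 := pi_gt0 R.
wlog tpi : t / t <= pi.
  move=> H t1 t2; have [/H->//|tpi] := leP t pi.
  have -> : cos t = cos (2 * pi - t).
    rewrite -cosN -(cosD2pi (- t)); congr cos.
    by rewrite mulr2n; ring.
  by apply: H; lra.
move=> t1 _; rewrite -cos_two_pi3; have [->//|ht] := eqVneq t (2 * (pi / 3)).
have {ht} : 2 * (pi / 3) < t by rewrite lt_neqAle eq_sym ht.
by move=> ht; rewrite ltW// ltr_cos// in_itv/=; apply/andP; split; lra.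
Qed.

(* Every angle of the triangle with sides [x], [y], [z] has cosine at least
   [- m]. *)
Definition obtuse_le {R : realType} (m x y z : R) :=
  [/\ x ^+ 2 <= y ^+ 2 + z ^+ 2 + 2 * m * (y * z),
      y ^+ 2 <= x ^+ 2 + z ^+ 2 + 2 * m * (x * z) &
      z ^+ 2 <= x ^+ 2 + y ^+ 2 + 2 * m * (x * y)].

(** Since [2 m < 2], the right side is strictly below [(y + z)^2]; the comparison triangles are thus
    nondegenerate. *)
Lemma sqr_lt_add (R : realType) (m x y z : R) : m <= 1 / 2 ->
  0 < x -> 0 < y -> 0 < z -> x ^+ 2 <= y ^+ 2 + z ^+ 2 + 2 * m * (y * z) ->
  x < y + z.
Proof.
move=> m12 x0 y0 z0 h; rewrite -(@ltr_pXn2r _ 2%N) ?nnegrE//; try lra.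
have yz := mulr_gt0 y0 z0; have : m * (y * z) <= 1 / 2 * (y * z).
  by rewrite ler_wpM2r// ltW.
by rewrite sqrrD; lra.
Qed.

(* [T] is twice the area of the triangle. *)
Lemma triangle_angles (R : realType) (m x y z : R) : m <= 1 / 2 ->
  0 < x -> 0 < y -> 0 < z -> obtuse_le m x y z ->
  exists t1 t2 t3 T : R,
  [/\ [/\ t1 + t2 + t3 = pi, t1 <= 2 * (pi / 3), t2 <= 2 * (pi / 3)
          & t3 <= 2 * (pi / 3)],
      0 < T /\ T ^+ 2 = (x * y) ^+ 2 - ((x ^+ 2 + y ^+ 2 - z ^+ 2) / 2) ^+ 2,
      x * y * cos t1 = (x ^+ 2 + y ^+ 2 - z ^+ 2) / 2 /\ x * y * sin t1 = T,
      y * z * cos t2 = (y ^+ 2 + z ^+ 2 - x ^+ 2) / 2 /\ y * z * sin t2 = T &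
      x * z * cos t3 = (x ^+ 2 + z ^+ 2 - y ^+ 2) / 2 /\ x * z * sin t3 = T].
Proof.
move=> m12 x0 y0 z0 [hx hy hz].
have pi0 := pi_gt0 R.
have lx := @sqr_lt_add R m x y z m12 x0 y0 z0 hx.
have ly := @sqr_lt_add R m y x z m12 y0 x0 z0 hy.
have lz := @sqr_lt_add R m z x y m12 z0 x0 y0 hz.
pose D : R := (x * y) ^+ 2 - ((x ^+ 2 + y ^+ 2 - z ^+ 2) / 2) ^+ 2.
have D0 : 0 < D.
  (* Heron's formula. *)
  have -> : D = (x + y + z) * (x + y - z) * ((z + x - y) * (z + y - x)) / 4.
    by rewrite /D; field.
  by rewrite divr_gt0// !mulr_gt0//; lra.
pose T := Num.sqrt D.
have T0 : 0 < T by rewrite sqrtr_gt0.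
have TT : T ^+ 2 = D by rewrite sqr_sqrtr// ltW.
have angle (u v w : R) : 0 < u -> 0 < v -> 
    w ^+ 2 <= u ^+ 2 + v ^+ 2 + 2 * m * (u * v) ->
    (u * v) ^+ 2 - ((u ^+ 2 + v ^+ 2 - w ^+ 2) / 2) ^+ 2 = D ->
    exists2 t, 0 <= t <= 2 * (pi / 3) &
    u * v * cos t = (u ^+ 2 + v ^+ 2 - w ^+ 2) / 2 /\ u * v * sin t = T.
  move=> u0 v0 hw uvD; have uv := mulr_gt0 u0 v0.
  pose c := (u ^+ 2 + v ^+ 2 - w ^+ 2) / 2 / (u * v).
  have cE : u * v * c = (u ^+ 2 + v ^+ 2 - w ^+ 2) / 2.
    by rewrite /c mulrC divfK// gt_eqF.
  have c2 : (u * v) ^+ 2 * (1 - c ^+ 2) = D.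
    by rewrite mulrBr mulr1 -exprMn cE.
  have c1 : 0 < 1 - c ^+ 2.
    by rewrite -(@pmulr_rgt0 _ ((u * v) ^+ 2)) ?c2// exprn_gt0.
  have cN1 : -1 <= c <= 1.
    by rewrite -ler_norml -(@ler_pXn2r _ 2%N) ?nnegrE// real_normK ?num_real//; lra.
  have cN : - (1 / 2) <= c.
    rewrite -(ler_pM2l uv) cE.
    have : m * (u * v) <= 1 / 2 * (u * v) by rewrite ler_wpM2r// ltW.
    lra.
  have cc : cos (acos c) = c by rewrite acosK// in_itv.
  exists (acos c).
    by rewrite acos_ge0//= ge_cos_two_pi3 ?acos_ge0 ?acos_lepi ?cc.
  rewrite cc; split => //; rewrite sin_acos//.
  apply/eqP; rewrite -(@eqrXn2 _ 2%N) ?mulr_ge0 ?sqrtr_ge0 ?(ltW u0) ?(ltW v0) ?(ltW T0)//.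
  by rewrite exprMn sqr_sqrtr ?(ltW c1)// c2 TT.
have [t1 /andP[t10 t1p] [t1c t1s]] := @angle x y z x0 y0 hz erefl.
have [t2 /andP[t20 t2p] [t2c t2s]] := @angle y z x y0 z0 ltac:(lra)
  ltac:(by rewrite /D; field).
have y20 : 0 < y ^+ 2 by rewrite exprn_gt0.
(* The third angle is taken to be [pi - t1 - t2], so the sum is [pi] by construction and the
   addition formulas identify its cosine and sine. *)
have c3 : x * z * cos (pi - t1 - t2) = (x ^+ 2 + z ^+ 2 - y ^+ 2) / 2.
  apply: (@mulfI _ (y ^+ 2)); first by rewrite gt_eqF.
  rewrite -addrA cosD cospi sinpi -opprD cosN cosD.
  transitivity ((x * y * sin t1) * (y * z * sin t2)
   - (x * y * cos t1) * (y * z * cos t2)); first ring.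
  by rewrite t1c t2c t1s t2s -expr2 TT /D; field.
have s3 : x * z * sin (pi - t1 - t2) = T.
  apply: (@mulfI _ (y ^+ 2)); first by rewrite gt_eqF.
  rewrite -addrA sinD cospi sinpi -opprD sinN sinD.
  transitivity ((x * y * sin t1) * (y * z * cos t2)
   + (x * y * cos t1) * (y * z * sin t2)); first ring.
  by rewrite t1c t2c t1s t2s; field.
have xz := mulr_gt0 x0 z0.
(* As [t1 + t2 <= 4 pi / 3], a negative value would lie in [[-pi / 3, 0)] and have nonpositive sine,
   while [T > 0]. *)
have t30 : 0 <= pi - t1 - t2.
  rewrite leNgt; apply/negP => t3.
  have : 0 <= sin (- (pi - t1 - t2)) by apply: sin_ge0_pi; lra.
  rewrite sinN -(pmulr_rge0 _ xz) mulrN s3; lra.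
exists t1, t2, (pi - t1 - t2), T; split => //; split => //; first ring.
apply: ge_cos_two_pi3 => //; first lra.
rewrite -(ler_pM2l xz) c3.
have : m * (x * z) <= 1 / 2 * (x * z) by rewrite ler_wpM2r// ltW.
lra.
Qed.

(* The sum [2 pi] of the angles of both triangles leaves a pair of corresponding
   angles with [2 pi / 3 <= s + t <= 4 pi / 3]. *)
Lemma angle_pair_sum (R : realType) (s1 s2 s3 t1 t2 t3 : R) :
  s1 + s2 + s3 = pi -> t1 + t2 + t3 = pi ->
  s1 <= 2 * (pi / 3) -> s2 <= 2 * (pi / 3) -> s3 <= 2 * (pi / 3) ->
  t1 <= 2 * (pi / 3) -> t2 <= 2 * (pi / 3) -> t3 <= 2 * (pi / 3) ->
  [\/ cos (s1 + t1) <= - (1 / 2), cos (s2 + t2) <= - (1 / 2)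
    | cos (s3 + t3) <= - (1 / 2)].
Proof.
move=> hs ht s1p s2p s3p t1p t2p t3p.
have [h1|h1] := leP (2 * (pi / 3)) (s1 + t1).
  by apply: Or31; apply: cos_le_Nhalf => //; lra.
have [h2|h2] := leP (2 * (pi / 3)) (s2 + t2).
  by apply: Or32; apply: cos_le_Nhalf => //; lra.
by apply: Or33; apply: cos_le_Nhalf; lra.
Qed.

(** * The lower bound for Euclidean comparison triangles *)

(** A combination of [cos (s + t) <= -1/2] and [cos (s - t) <= 1] with weights [2 + 2 m] and
    [1 - 2 m], divided by 3. Equality holds at [s = t = pi / 3]. *)
Lemma cos_pair_bound (R : realType) (m s t : R) : m <= 1 / 2 ->
  cos (s + t) <= - (1 / 2) -> 0 <= m ->
  m + cos s * cos t <= (4 * m + 1) / 3 * (sin s * sin t).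
Proof.
move=> m12 h m0; have := cos_le1 (s - t); rewrite cosB cosD in h * => h'.
have : m * (cos s * cos t - sin s * sin t) <= m * - (1 / 2) by rewrite ler_wpM2l.
have : (1 - 2 * m) * (cos s * cos t + sin s * sin t) <= (1 - 2 * m) * 1.
  by rewrite ler_wpM2l//; lra.
lra.
Qed.

Lemma pair_bound_scale (R : realType) (m u v cu cv T1 T2 s t : R) :
  m <= 1 / 2 -> 0 <= m -> 0 < u -> 0 < v ->
  u * cos s = cu -> v * cos t = cv -> u * sin s = T1 -> v * sin t = T2 ->
  cos (s + t) <= - (1 / 2) ->
  m * (u * v) + cu * cv <= (4 * m + 1) / 3 * (T1 * T2).
Proof.
move=> m12 m0 u0 v0 <- <- <- <- h.
have := @cos_pair_bound R m s t m12 h m0.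
have uv := mulr_gt0 u0 v0.
rewrite -(ler_pM2l uv); lra.
Qed.

(* The three hypotheses on [W] bound the correlation between [A] and [B] after
   basing the Schoenberg matrix at [P], at [O], and after inverting at [P]. *)
Lemma lower_bound_alg (R : realType) (m a b p x y W Gao Gbo Gab : R) :
  0 <= m -> m <= 1 / 2 -> 0 < a -> 0 < b -> 0 < p -> 0 < x -> 0 < y ->
  obtuse_le m a p x -> obtuse_le m b p y ->
  W <= a ^+ 2 + b ^+ 2 + 2 * m * (a * b) ->
  W <= x ^+ 2 + y ^+ 2 + 2 * m * (x * y) ->
  W * p ^+ 2 <= (a * y) ^+ 2 + (b * x) ^+ 2 + 2 * m * ((a * y) * (b * x)) ->
  Gao = (a ^+ 2 + p ^+ 2 - x ^+ 2) / 2 ->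
  Gbo = (b ^+ 2 + p ^+ 2 - y ^+ 2) / 2 ->
  Gab = (a ^+ 2 + b ^+ 2 - W) / 2 ->
  - ((4 * m + 1) / 3 * (Num.sqrt ((a * p) ^+ 2 - Gao ^+ 2) *
       Num.sqrt ((b * p) ^+ 2 - Gbo ^+ 2))) <= Gab * p ^+ 2 - Gao * Gbo.
Proof.
move=> m0 m12 a0 b0 p0 x0 y0 ta tb W1 W2 W3 -> -> ->.
have [s1 [s2 [s3 [T [[hs s1p s2p s3p] [T0 TT] [c1 n1] [c2 n2] [c3 n3]]]]]] :=
  @triangle_angles R m a p x m12 a0 p0 x0 ta.
have [t1 [t2 [t3 [U [[ht t1p t2p t3p] [U0 UU] [d1 k1] [d2 k2] [d3 k3]]]]]] :=
  @triangle_angles R m b p y m12 b0 p0 y0 tb.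
rewrite -TT -UU !sqrtr_sqr !gtr0_norm//.
have p20 : 0 < p ^+ 2 by rewrite exprn_gt0.
have sc := fun u v cu cv s t => @pair_bound_scale R m u v cu cv T U s t m12 m0.
(* [T] and [U] serve all three pairs. The numerator keeps its value when the Schoenberg entries are
   based at [O]; for the angles at [A] and [B] it is a similar identity, with [W p^2] compared to
   [(a y)^2 + (b x)^2]. *)
case: (@angle_pair_sum R s1 s2 s3 t1 t2 t3) => // hst.
- have := sc _ _ _ _ _ _ (mulr_gt0 a0 p0) (mulr_gt0 b0 p0) c1 d1 n1 k1 hst.
  have := ler_wpM2r (ltW p20) W1; lra.
- have := sc _ _ _ _ _ _ (mulr_gt0 p0 x0) (mulr_gt0 p0 y0) c2 d2 n2 k2 hst.
  have := ler_wpM2r (ltW p20) W2; lra.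
- have := sc _ _ _ _ _ _ (mulr_gt0 a0 x0) (mulr_gt0 b0 y0) c3 d3 n3 k3 hst.
  move: W3; lra.
Qed.

(** * The upper bound *)

Lemma powR_superadditive (R : realType) (q a b : R) : 1 <= q ->
  0 <= a -> 0 <= b -> a `^ q + b `^ q <= (a + b) `^ q.
Proof.
move=> q1 a0 b0; have := @powR_defect_mono R q a b 0 q1 a0 (lexx _) b0.
rewrite addr0 powR0; last lra.
lra.
Qed.

(** Here [e] and [k] are the extreme values of [E] and [K]. The numerator is at most
    [e N <= m^2 u w], and the two roots are at least [r u] and [r w] with [r^2 = 1 - m^2]. *)
Lemma upper_bound_alg (R : realType) (m u w e E k K N B H : R) :
  0 <= m -> m <= 1 / 2 -> 0 <= u -> 0 <= w ->
  0 <= E -> E <= e -> e <= m * u -> 0 <= K -> K <= k ->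
  0 <= N -> N <= m * w -> B - k ^+ 2 = w ^+ 2 - N ^+ 2 ->
  e * (k - N) <= H ->
  E * K - H <= m ^+ 2 / (1 - m ^+ 2) *
    (Num.sqrt (u ^+ 2 - E ^+ 2) * Num.sqrt (B - K ^+ 2)).
Proof.
move=> m0 m12 u0 w0 E0 Ee eu K0 Kk N0 Nw BE HE.
have m2 : 0 < 1 - m ^+ 2.
  by rewrite subr_gt0 expr_lt1//; lra.
set r := Num.sqrt (1 - m ^+ 2).
have r0 : 0 < r by rewrite sqrtr_gt0.
have rr : r ^+ 2 = 1 - m ^+ 2 by rewrite sqr_sqrtr// ltW.
have sq (c t y : R) : 0 <= c -> c ^+ 2 - (m * c) ^+ 2 <= t -> c * r <= Num.sqrt t.
  move=> c0 h; rewrite -[leLHS]ger0_norm ?mulr_ge0 ?(ltW r0)// -sqrtr_sqr.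
  by apply: ler_wsqrtr; rewrite exprMn rr; lra.
have h1 : u * r <= Num.sqrt (u ^+ 2 - E ^+ 2).
  by apply: sq => //; rewrite lerD2l lerN2 ler_sqr ?nnegrE ?mulr_ge0//; lra.
have h2 : w * r <= Num.sqrt (B - K ^+ 2).
  apply: sq => //; have : K ^+ 2 <= k ^+ 2 by rewrite ler_sqr ?nnegrE//; lra.
  have : N ^+ 2 <= (m * w) ^+ 2 by rewrite ler_sqr ?nnegrE ?mulr_ge0//; lra.
  lra.
apply: (@le_trans _ _ ((m * u) * (m * w))).
  have : E * K <= e * k by apply: ler_pM.
  have : e * N <= (m * u) * (m * w) by apply: ler_pM => //; lra.
  lra.
have -> : m * u * (m * w) = m ^+ 2 / (1 - m ^+ 2) * ((u * r) * (w * r)).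
  transitivity (m ^+ 2 / (1 - m ^+ 2) * (r ^+ 2) * (u * w)); last ring.
  by rewrite rr divfK ?gt_eqF//; ring.
by rewrite ler_wpM2l ?divr_ge0 ?sqr_ge0 ?(ltW m2)// ler_pM ?mulr_ge0 ?(ltW r0).
Qed.

(* The extreme case is [x = a + p], [y = `|b - p|], that of points on a line.
   There the triangle [PBO] is degenerate, and Heron's formula can be read at its
   middle vertex, whose angle has cosine in [[-m, 0]]. *)
Lemma upper_bound_mixed (R : realType) (q m a b p x y Gao Gbo Gab : R) :
  1 <= q -> q <= 2 -> 2 `^ q <= 3 -> m = (2 `^ q - 2) / 2 -> 0 < a -> 0 < b -> 0 < p ->
  0 <= x -> 0 <= y -> x <= a + p -> b <= p + y -> p <= b + y ->
  Gao = (a `^ q + p `^ q - x `^ q) / 2 ->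
  Gbo = (b `^ q + p `^ q - y `^ q) / 2 ->
  Gab = (a `^ q + b `^ q - (a + b) `^ q) / 2 ->
  Gao <= 0 -> 0 <= Gbo ->
  Gab * p `^ q - Gao * Gbo <= m ^+ 2 / (1 - m ^+ 2) *
    (Num.sqrt (a `^ q * p `^ q - Gao ^+ 2) *
     Num.sqrt (b `^ q * p `^ q - Gbo ^+ 2)).
Proof.
move=> q1 q2 q3 mq a0 b0 p0 x0 y0 xap bpy pby Eao Ebo Eab Gao0 Gbo0.
have q0 : 0 <= q by lra.
have a0' := ltW a0; have b0' := ltW b0; have p0' := ltW p0.
have m0 : 0 <= m.
  have := @ler_powR R 2 ltac:(lra) 1 q q1.
  by rewrite powRr1 ?mq; lra.
have m12 : m <= 1 / 2 by lra.
have mE : 2 `^ q - 2 = 2 * m by lra.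
have mono (s t : R) : 0 <= s -> s <= t -> s `^ q <= t `^ q.
  by move=> s0 st; apply: ge0_ler_powR; rewrite ?nnegrE//; lra.
pose h s t : R := (s + t) `^ q - s `^ q - t `^ q.
have h0 (s t : R) : 0 <= s -> 0 <= t -> 0 <= h s t.
  move=> s0 t0; have := @powR_superadditive R q s t q1 s0 t0.
  by rewrite /h; lra.
have hm (s t : R) : 0 <= s -> 0 <= t -> 
    h s t / 2 <= m * (s `^ (q / 2) * t `^ (q / 2)).
  by move=> s0 t0; have := @powR_add_le R q s t q1 q2 s0 t0; rewrite /h mE; lra.
(* [n] and [d] are the sides at the middle vertex of the flat triangle [PBO], [d] being the side
   [BO]; [k] is the value of [Gbo] there. *)
have core (n d k : R) : 0 <= n -> 0 <= d -> 
    d `^ q <= y `^ q -> k = (b `^ q + p `^ q - d `^ q) / 2 ->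
    b `^ q * p `^ q - k ^+ 2 = n `^ q * d `^ q - (h n d / 2) ^+ 2 ->
    h a p * (k - h n d / 2) <= h a b * p `^ q ->
    Gab * p `^ q - Gao * Gbo <= m ^+ 2 / (1 - m ^+ 2) *
    (Num.sqrt (a `^ q * p `^ q - Gao ^+ 2) *
     Num.sqrt (b `^ q * p `^ q - Gbo ^+ 2)).
  move=> n0 d0 dy kE BE HE.
  have := @upper_bound_alg R m (a `^ (q / 2) * p `^ (q / 2))
    (n `^ (q / 2) * d `^ (q / 2)) (h a p / 2) (- Gao) k Gbo (h n d / 2)
    (b `^ q * p `^ q) (h a b * p `^ q / 2) m0 m12.
  rewrite !exprMn !powR_half_sqr sqrrN.
  have -> : - Gao * Gbo - h a b * p `^ q / 2 = Gab * p `^ q - Gao * Gbo.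
    by rewrite Eab /h; lra.
  apply => //.
  - by rewrite mulr_ge0 ?powR_ge0.
  - by rewrite mulr_ge0 ?powR_ge0.
  - by rewrite oppr_ge0.
  - have {mono} := mono x (a + p) x0 xap; rewrite Eao /h => H; clear -H; lra.
  - exact: hm.
  - by rewrite kE Ebo ler_pM2r ?invr_gt0// lerD2l lerN2.
  - by rewrite divr_ge0 ?h0.
  - exact: hm.
  - by rewrite -exprMn.
  - by rewrite [_ / 2 * _]mulrAC ler_pM2r ?invr_gt0.
have [bp|/ltW pb] := leP b p.
- apply: (core b (p - b) ((b `^ q + p `^ q - (p - b) `^ q) / 2)) => //.
  + by rewrite subr_ge0.
  + by apply: mono; [rewrite subr_ge0 | rewrite lerBlDl].
  + by rewrite /h (_ : b + (p - b) = p); [field | ring].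
  (* The claim becomes [h a p * b^q <= h a b * p^q], the product of [powR_defect_scale] and
     [b^(q-1) <= p^(q-1)]. *)
  + have -> : (b `^ q + p `^ q - (p - b) `^ q) / 2 - h b (p - b) / 2 = b `^ q.
      by rewrite /h (_ : b + (p - b) = p); [field | ring].
    rewrite (@powR_succ R q b)// (@powR_succ R q p)//.
    have s1 : b * h a p <= p * h a b by exact: powR_defect_scale.
    have hab : 0 <= p * h a b by rewrite mulr_ge0 ?h0.
    have bpq : b `^ (q - 1) <= p `^ (q - 1).
      by apply: ge0_ler_powR; rewrite ?nnegrE// subr_ge0.
    rewrite mulrA [_ * b]mulrC [X in _ <= X]mulrA [h a b * p]mulrC.
    by apply: ler_pM => //; rewrite ?mulr_ge0 ?h0 ?powR_ge0.
- apply: (core p (b - p) ((b `^ q + p `^ q - (b - p) `^ q) / 2)) => //.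
  + by rewrite subr_ge0.
  + by apply: mono; [rewrite subr_ge0 | rewrite lerBlDl].
  + by rewrite /h (_ : p + (b - p) = b); [field | ring].
  + have -> : (b `^ q + p `^ q - (b - p) `^ q) / 2 - h p (b - p) / 2 = p `^ q.
      by rewrite /h (_ : p + (b - p) = b); [field | ring].
    by rewrite ler_wpM2r ?powR_ge0//; exact: powR_defect_mono.
Qed.

(** * From the metric to comparison triangles *)

Lemma obtuse_le_powR (R : realType) (q x y z : R) : 1 <= q -> q <= 2 ->
  0 <= x -> 0 <= y -> 0 <= z -> x <= y + z -> y <= x + z -> z <= x + y ->
  obtuse_le ((2 `^ q - 2) / 2) (x `^ (q / 2)) (y `^ (q / 2)) (z `^ (q / 2)).
Proof.
move=> q1 q2 x0 y0 z0 hx hy hz.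
have side (u v w : R) : 0 <= u -> 0 <= v -> 0 <= w -> u <= v + w ->
    u `^ q <= v `^ q + w `^ q +
      2 * ((2 `^ q - 2) / 2) * (v `^ (q / 2) * w `^ (q / 2)).
  move=> u0 v0 w0 uvw.
  have := @powR_add_le R q v w q1 q2 v0 w0.
  have : u `^ q <= (v + w) `^ q.
    by apply: ge0_ler_powR; rewrite ?nnegrE//; lra.
  lra.
by rewrite /obtuse_le !powR_half_sqr; split; apply: side.
Qed.

Lemma powR2_log2 (R : realType) (x : R) : 0 < x -> 2 `^ (log2 x) = x.
Proof.
move=> x0; have l2 : ln 2 != 0 :> R by rewrite gt_eqF// ln_gt0//; lra.
by rewrite /powR pnatr_eq0/= /log2 divfK// lnK.
Qed.

(** Clearing the common factor [G O O = Z] turns the roots into twice the areas of the comparison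
    triangles [PAO] and [PBO]. *)
Lemma partial_corrE (R : realType) (X : metricType R) (q : R) (A B P O : X) :
  0 < q -> P != O ->
  let Z := mdist P O `^ q in
  let G := schoenberg q P in
  0 <= G A A * Z - G A O ^+ 2 ->
  partial_corr q A B P O = (G A B * Z - G A O * G B O) /
    (Num.sqrt (G A A * Z - G A O ^+ 2) * Num.sqrt (G B B * Z - G B O ^+ 2)).
Proof.
move=> q0 PO Z G D1.
have Z0 : 0 < Z by rewrite powR_gt0// mdist_gt0.
have GOO : G O O = Z.
  by rewrite /G /schoenberg mdistxx powR0 ?gt_eqF// /Z; field.
have Gsym (x : X) : G O x = G x O.
  by rewrite /G /schoenberg (metric_sym O x) addrC [X in X - _]addrC addrC.
have schurE (x y : X) : schur q P O x y = (G x y * Z - G x O * G y O) / Z.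
  by rewrite /schur -/G GOO Gsym; field; rewrite gt_eqF.
rewrite /partial_corr !schurE -!expr2.
have -> : (G A A * Z - G A O ^+ 2) / Z * ((G B B * Z - G B O ^+ 2) / Z) =
    Z^-1 ^+ 2 * ((G A A * Z - G A O ^+ 2) * (G B B * Z - G B O ^+ 2)).
  by field; rewrite gt_eqF.
rewrite sqrtrM ?sqr_ge0// sqrtr_sqr gtr0_norm ?invr_gt0// sqrtrM//.
by rewrite invfM invrK mulrA divfK// gt_eqF.
Qed.

(** * The extremal four-point space *)

(* The graph metric of [K_4] minus the edge between [(false, false)] and
   [(true, true)]. *)
Definition diamond_ndist (x y : bool * bool) : nat :=
  if x == y then 0%N else if (x.1 == x.2) && (y.1 == y.2) then 2%N else 1%N.

Lemma diamond_ndist_triangle x y z :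
  (diamond_ndist x z <= diamond_ndist x y + diamond_ndist y z)%N.
Proof. by move: x y z => [[] []] [[] []] [[] []]. Qed.

Lemma diamond_ndist_ptolemaic x y z w :
  (diamond_ndist x y * diamond_ndist z w <=
    diamond_ndist x z * diamond_ndist y w +
    diamond_ndist x w * diamond_ndist y z)%N.
Proof. by move: x y z w => [[] []] [[] []] [[] []] [[] []]. Qed.

(* An alias, since [bool * bool] already carries the product topology. *)
Definition diamond (R : realType) : Type := (bool * bool)%type.

HB.instance Definition _ (R : realType) := Choice.copy (diamond R) (bool * bool)%type.

Definition diamond_dist (R : realType) (x y : diamond R) : R :=
  (diamond_ndist x y)%:R.

Lemma diamond_distxx (R : realType) (x : diamond R) : diamond_dist R x x = 0.
Proof. by rewrite /diamond_dist /diamond_ndist eqxx. Qed.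

Lemma diamond_dist_eq0 (R : realType) (x y : diamond R) :
  diamond_dist R x y = 0 -> x = y.
Proof.
by move=> /eqP; rewrite /diamond_dist pnatr_eq0; move: x y => [[] []] [[] []].
Qed.

Lemma diamond_distC (R : realType) (x y : diamond R) :
  diamond_dist R x y = diamond_dist R y x.
Proof. by congr _%:R; move: x y => [[] []] [[] []]. Qed.

Lemma diamond_dist_triangle (R : realType) (y x z : diamond R) :
  diamond_dist R x z <= diamond_dist R x y + diamond_dist R y z.
Proof. by rewrite -natrD ler_nat diamond_ndist_triangle. Qed.

HB.instance Definition _ (R : realType) := isMetric.Build R (diamond R)
  (@diamond_distxx R) (@diamond_dist_eq0 R) (@diamond_distC R)
  (@diamond_dist_triangle R).

Lemma diamond_ptolemaic (R : realType) : ptolemaic (diamond R).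
Proof.
move=> x y z w; rewrite /mdist/= /diamond_dist -!natrM -natrD ler_nat.
exact: diamond_ndist_ptolemaic.
Qed.

(** The triangles [PAO] and [PBO] are equilateral, which is the equality case [s = t = pi / 3] of
    [cos_pair_bound]. *)
Lemma diamond_partial_corr (R : realType) (q : R) : 0 < q ->
  partial_corr q ((false, false) : diamond R) (true, true) (false, true)
    (true, false) = - kappa q.
Proof.
move=> q0.
have dE : ((diamond_ndist (false, false) (false, false) = 0%N) *
    (diamond_ndist (false, false) (true, true) = 2%N) *
    (diamond_ndist (true, true) (true, false) = 1%N) *
    (diamond_ndist (false, false) (true, false) = 1%N) *
    (diamond_ndist (false, true) (true, false) = 1%N) *
    (diamond_ndist (false, true) (false, false) = 1%N) *
    (diamond_ndist (false, true) (true, true) = 1%N))%type by [].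
have S34 : (1 + 1 - 0) / 2 * 1 - ((1 + 1 - 1) / 2) ^+ 2 = 3 / 4 :> R by field.
rewrite partial_corrE// /schoenberg /mdist/= /diamond_dist/= ?dE.
  rewrite powR0 ?gt_eqF// powR1 !S34 -[Num.sqrt _ * _]expr2 sqr_sqrtr; last lra.
  rewrite /kappa powRD ?pnatr_eq0 ?implybT// powRr1//; field.
  by [].
rewrite /schoenberg /mdist/= /diamond_dist/= ?dE.
by rewrite powR0 ?gt_eqF// powR1 S34; lra.
Qed.

(** * Both bounds, sharpness and the value at [log2 (9 / 4)] *)

Theorem theorem4p2 (R : realType) :
  (forall q : R, 1 <= q -> q <= log2 3 ->
     (forall (X : metricType R) (A P B O : X),
        ptolemaic X -> uniq [:: A; P; B; O] ->
        mdist A B = mdist A P + mdist P B ->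
        - kappa q <= partial_corr q A B P O /\
        partial_corr q A B P O <= lambda q) /\
     (forall c : R, - kappa q < c ->
        ~ (forall (X : metricType R) (A P B O : X),
             ptolemaic X -> uniq [:: A; P; B; O] ->
             mdist A B = mdist A P + mdist P B ->
             c <= partial_corr q A B P O))) /\
  - kappa (log2 (9 / 4) : R) = - (1 / 2).
Proof.
split; last first.
  rewrite /kappa powRD ?pnatr_eq0 ?implybT// powRr1// powR2_log2; last lra.
  by field.
move=> q q1 qlog.
have q0 : 0 < q by lra.
have q3 : 2 `^ q <= 3.
  rewrite -[leRHS](@powR2_log2 R 3)//.
  by apply: ler_powR => //; lra.
have q2 : q <= 2.
  rewrite leNgt; apply/negP => /ltW.
  move/(@ler_powR R 2 ltac:(lra)); rewrite (powR_mulrn 2)//.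
  by move/le_trans/(_ q3); lra.
have q22 : 2 <= 2 `^ q.
  by have := @ler_powR R 2 ltac:(lra) 1 q q1; rewrite powRr1.
split=> [X A P B O pto|c kc H]; last first.
  have := H (diamond R) (false, false) (false, true) (true, true) (true, false)
    (@diamond_ptolemaic R) isT.
  rewrite diamond_partial_corr// leNgt kc => ab; apply/notF/ab.
  by rewrite /mdist/= /diamond_dist -natrD.
rewrite /= !inE !negb_or -!andbA andbT => /and5P[AP AB AO PB /andP[PO BO]] ABE.
set m := (2 `^ q - 2) / 2.
have m0 : 0 <= m by rewrite /m; lra.
have m12 : m <= 1 / 2 by rewrite /m; lra.
have kE : kappa q = (4 * m + 1) / 3.
  by rewrite /kappa /m powRD ?pnatr_eq0 ?implybT// powRr1//; field.
have m1 : 0 < 1 - m ^+ 2 by rewrite subr_gt0 expr_lt1//; lra.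
have lE : lambda q = m ^+ 2 / (1 - m ^+ 2).
  have -> : lambda q = (4 * m ^+ 2) / (4 - 4 * m ^+ 2).
    by rewrite /lambda /m; congr (_ / _); field.
  by field; rewrite !gt_eqF//; lra.
have l0 : 0 <= lambda q by rewrite lE divr_ge0 ?sqr_ge0 ?ltW.
set a := mdist A P in ABE; set b := mdist P B in ABE.
set p := mdist P O; set x := mdist A O; set y := mdist B O.
have a0 : 0 < a by rewrite mdist_gt0.
have b0 : 0 < b by rewrite mdist_gt0.
have p0 : 0 < p by rewrite mdist_gt0.
have x0 : 0 < x by rewrite mdist_gt0.
have y0 : 0 < y by rewrite mdist_gt0.
have t1 := metric_triangle A P O; have t2 := metric_triangle P A O.
have t3 := metric_triangle A O P; have t4 := metric_triangle B P O.
have t5 := metric_triangle P B O; have t6 := metric_triangle P O B.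
(* [t8] is the Ptolemaic inequality [(a + b) p <= a y + b x], up to symmetry of the distance. *)
have t7 := metric_triangle A O B; have t8 := pto A B P O.
move: t1 t2 t3 t4 t5 t6 t7 t8.
rewrite (metric_sym P A) (metric_sym O P) (metric_sym O B) (metric_sym B P) ABE.
rewrite -/a -/b -/p -/x -/y => t1 t2 t3 t4 t5 t6 t7 t8.
pose Gao := (a `^ q + p `^ q - x `^ q) / 2.
pose Gbo := (b `^ q + p `^ q - y `^ q) / 2.
pose Gab := (a `^ q + b `^ q - (a + b) `^ q) / 2.
pose a' := a `^ (q / 2); pose b' := b `^ (q / 2); pose p' := p `^ (q / 2).
pose x' := x `^ (q / 2); pose y' := y `^ (q / 2).
have ta : obtuse_le m a' p' x' by apply: obtuse_le_powR; lra.
have tb : obtuse_le m b' p' y' by apply: obtuse_le_powR; lra.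
have sqrE : ((a' ^+ 2 = a `^ q) * (b' ^+ 2 = b `^ q) * (p' ^+ 2 = p `^ q) *
  (x' ^+ 2 = x `^ q) * (y' ^+ 2 = y `^ q)) by rewrite !powR_half_sqr.
have a'0 : 0 < a' by exact: powR_gt0.
have b'0 : 0 < b' by exact: powR_gt0.
have p'0 : 0 < p' by exact: powR_gt0.
have x'0 : 0 < x' by exact: powR_gt0.
have y'0 : 0 < y' by exact: powR_gt0.
have D1 : 0 < a `^ q * p `^ q - Gao ^+ 2.
  have [? [? [? [T [_ [T0 TT] _ _ _]]]]] :=
    @triangle_angles R m a' p' x' m12 a'0 p'0 x'0 ta.
  by rewrite exprMn !sqrE in TT; rewrite -TT exprn_gt0.
have D2 : 0 < b `^ q * p `^ q - Gbo ^+ 2.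
  have [? [? [? [T [_ [T0 TT] _ _ _]]]]] :=
    @triangle_angles R m b' p' y' m12 b'0 p'0 y'0 tb.
  by rewrite exprMn !sqrE in TT; rewrite -TT exprn_gt0.
have GAA : schoenberg q P A A = a `^ q.
  by rewrite /schoenberg mdistxx powR0 ?gt_eqF// (metric_sym P A); field.
have GBB : schoenberg q P B B = b `^ q.
  by rewrite /schoenberg mdistxx powR0 ?gt_eqF//; field.
have GAO : schoenberg q P A O = Gao by rewrite /schoenberg (metric_sym P A).
have GAB : schoenberg q P A B = Gab by rewrite /schoenberg (metric_sym P A) ABE.
pose s := Num.sqrt (a `^ q * p `^ q - Gao ^+ 2) *
  Num.sqrt (b `^ q * p `^ q - Gbo ^+ 2).
have -> : partial_corr q A B P O = (Gab * p `^ q - Gao * Gbo) / s.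
  by rewrite partial_corrE//= GAA ?GBB ?GAO ?GAB//; exact: ltW.
have s0 : 0 < s by rewrite mulr_gt0 ?sqrtr_gt0.
have le_q (u v : R) : 0 <= u -> u <= v -> u `^ q <= v `^ q.
  by move=> u0 uv; apply: ge0_ler_powR; rewrite ?nnegrE//; lra.
have add_le (u v : R) : 0 <= u -> 0 <= v ->
    (u + v) `^ q <= u `^ q + v `^ q + 2 * m * (u `^ (q / 2) * v `^ (q / 2)).
  by move=> u0 v0; have := @powR_add_le R q u v q1 q2 u0 v0; rewrite /m; lra.
split.
  rewrite ler_pdivlMr// kE mulNr /s -!sqrE -!exprMn.
  (* The three bounds on [(a + b)^q] combine [add_le] with [AB = a + b], with [AB <= x + y] and with
     the Ptolemaic inequality. *)
  apply: (@lower_bound_alg R m a' b' p' x' y' ((a + b) `^ q)) => //;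
    rewrite ?sqrE//.
  - by apply: add_le; lra.
  - by apply: (le_trans (le_q _ _ _ t7)); [lra | apply: add_le; lra].
  - have ay0 : 0 <= a * y by apply: mulr_ge0; exact: ltW.
    have bx0 : 0 <= b * x by apply: mulr_ge0; exact: ltW.
    have ab0 : 0 <= a + b by rewrite addr_ge0 ?ltW.
    have : ((a + b) * p) `^ q <= (a * y + b * x) `^ q.
      by apply: le_q; [rewrite mulr_ge0 ?(ltW p0) | lra].
    move/le_trans/(_ (add_le _ _ ay0 bx0)).
    have [ga gb gp] := And3 (ltW a0) (ltW b0) (ltW p0).
    by rewrite !powRM ?(ltW x0) ?(ltW y0)// !exprMn !sqrE.
rewrite ler_pdivrMr//.
have Gab0 : Gab * p `^ q <= 0.
  rewrite mulr_le0_ge0 ?powR_ge0// /Gab.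
  by have := @powR_superadditive R q a b q1 (ltW a0) (ltW b0); lra.
have ls : 0 <= lambda q * s by rewrite mulr_ge0 ?(ltW s0).
(* For equal signs the numerator is nonpositive, since [Gab <= 0] by superadditivity. *)
have [GG|GG] := leP 0 (Gao * Gbo); first lra.
have [Gao0|Gao0] := leP Gao 0.
  rewrite lE /s; apply: (@upper_bound_mixed R q m a b p x y) => //; try lra.
  rewrite leNgt; apply: contraTN GG => Gbo0.
  by rewrite -leNgt mulr_le0 ?(ltW Gbo0).
(* The remaining sign pattern follows by exchanging [A] and [B]. *)
rewrite lE /s [Num.sqrt _ * _]mulrC [Gao * _]mulrC.
apply: (@upper_bound_mixed R q m b a p y x) => //; try lra.
  by rewrite /Gab [b + a]addrC [b `^ q + _]addrC.
by rewrite -(pmulr_rle0 _ Gao0) ltW.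
Qed.
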